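(* Let $\mathfrak{C}\prec\mathfrak{C}'$ be models of a complete first-order theory $T$, both at least $(\aleph_0+\lambda)^+$-saturated and strongly $(\aleph_0+\lambda)^+$-homogeneous, and let $X$ be a $\emptyset$-type-definable subset of $\mathfrak{C}^\lambda$. Then $F'_{\mathrm{Tame}}$ and $F_{\mathrm{Tame}}$ are compatible, i.e. $r[F'_{\mathrm{Tame}}]=F_{\mathrm{Tame}}$ where $r:S_X(\mathfrak{C}')\to S_X(\mathfrak{C})$ is the restriction map.
   Context: $S_X(\mathfrak{C})$ is the space of complete types over $\mathfrak{C}$ extending the type defining $X$, a flow under $\mathrm{Aut}(\mathfrak{C})$ (pointwise convergence topology). For a flow $(G,Y)$ and $f\in C(Y)$, $(gf)(y)=f(g^{-1}y)$. A sequence $(f_n)_{n<\omega}$ in $C(Y)$ is independent if there are reals $r<s$ with $\bigcap_{n\in P}f_n^{-1}(-\infty,r)\cap\bigcap_{n\in M}f_n^{-1}(s,\infty)\neq\emptyset$ for all finite disjoint $P,M\subseteq\omega$. $f$ is tame if $\{gf:g\in G\}$ contains no independent sequence; the flow is tame if every $f\in C(Y)$ is tame. $F_{\mathrm{Tame}}$ is the finest closed $\mathrm{Aut}(\mathfrak{C})$-invariant equivalence relation on $S_X(\mathfrak{C})$ whose quotient flow is tame (it exists); $F'_{\mathrm{Tame}}$ is the analogous relation for $\mathfrak{C}'$. $r[F']=\{(r(a),r(b)):(a,b)\in F'\}$. *)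

(* Defs.v *)
From Stdlib Require List.
From HB Require Import structures.
From mathcomp Require Import all_boot all_order all_algebra.
From mathcomp Require Import all_classical all_reals all_analysis.

Set Implicit Arguments.
Unset Strict Implicit.
Unset Printing Implicit Defensive.

Import numFieldNormedType.Exports.
Local Open Scope classical_set_scope.

Record language := Language {
  fsym : Type;
  farity : fsym -> nat;
  rsym : Type;
  rarity : rsym -> nat
}.

Inductive term (L : language) (V : Type) : Type :=
| Var of V
| App (f : fsym L) of ('I_(farity f) -> term L V).
Arguments Var {L V} _.
Arguments App {L V} _ _.

(* Formulas with free variables in V. The variable bound by [All] is the
   point [None] of [option V]. *)
Inductive formula (L : language) (V : Type) : Type :=
| Bot
| Eq of term L V & term L V
| Rel (r : rsym L) of ('I_(rarity r) -> term L V)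
| Imp of formula L V & formula L V
| All of formula L (option V).
Arguments Bot {L V}.
Arguments Eq {L V} _ _.
Arguments Rel {L V} _ _.
Arguments Imp {L V} _ _.
Arguments All {L V} _.

Definition Not L (V : Type) (phi : formula L V) : formula L V := Imp phi Bot.

Definition sentence (L : language) := formula L void.

Fixpoint term_map L (V W : Type) (h : V -> W) (t : term L V) : term L W :=
  match t with
  | Var v => Var (h v)
  | App f a => App f (fun i => term_map h (a i))
  end.

Fixpoint formula_map L (V W : Type) (h : V -> W) (phi : formula L V) {struct phi} :
    formula L W :=
  match phi with
  | Bot => Bot
  | Eq s t => Eq (term_map h s) (term_map h t)
  | Rel r a => Rel r (fun i => term_map h (a i))
  | Imp phi psi => Imp (formula_map h phi) (formula_map h psi)
  | All phi => All (formula_map (omap h) phi)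
  end.

Record structure (L : language) := Structure {
  carrier :> Type;
  carrier_inhabited : inhabited carrier;
  fint : forall f : fsym L, ('I_(farity f) -> carrier) -> carrier;
  rint : forall r : rsym L, ('I_(rarity r) -> carrier) -> Prop
}.
Arguments fint {L} _ _ _.
Arguments rint {L} _ _ _.

Fixpoint eval L (V : Type) (M : structure L) (e : V -> M) (t : term L V) : M :=
  match t with
  | Var v => e v
  | App f a => fint M f (fun i => eval e (a i))
  end.

Definition env_cons (V T : Type) (x : T) (e : V -> T) (o : option V) : T :=
  if o is Some v then e v else x.

Fixpoint sat L (V : Type) (M : structure L) (phi : formula L V) {struct phi} :
    (V -> M) -> Prop :=
  match phi with
  | Bot => fun=> False
  | Eq s t => fun e => eval e s = eval e t
  | Rel r a => fun e => rint M r (fun i => eval e (a i))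
  | Imp phi psi => fun e => sat phi e -> sat psi e
  | All phi => fun e => forall x : M, sat phi (env_cons x e)
  end.

Definition models L (M : structure L) (T : set (sentence L)) :=
  forall phi, T phi -> sat phi (of_void M).

Definition entails L (T : set (sentence L)) (phi : sentence L) :=
  forall M : structure L, models M T -> sat phi (of_void M).

Definition complete_theory L (T : set (sentence L)) :=
  (exists M : structure L, models M T) /\
  forall phi : sentence L, entails T phi \/ entails T (Not phi).

Definition elementary L (M N : structure L) (j : M -> N) :=
  forall (V : Type) (phi : formula L V) (e : V -> M),
    sat phi e <-> sat phi (j \o e).

Record automorphism L (M : structure L) := Automorphism {
  aut_fun :> M -> M;
  aut_inv : M -> M;
  aut_funK : cancel aut_fun aut_inv;
  aut_invK : cancel aut_inv aut_fun;
  aut_fint : forall f a, aut_fun (fint M f a) = fint M f (aut_fun \o a);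
  aut_rint : forall r a, rint M r a <-> rint M r (aut_fun \o a)
}.

HB.instance Definition _ L (M : structure L) := gen_eqMixin (automorphism M).
HB.instance Definition _ L (M : structure L) :=
  gen_choiceMixin (automorphism M).

Section AutGroup.
Variables (L : language) (M : structure L).
Implicit Types g h : automorphism M.

Lemma aut_ext g h : g =1 h -> g = h.
Proof.
case: g => f f' fK f'K ff fr; case: h => k k' kK k'K kf kr /= /funext E.
subst k; have E : f' = k' by apply/funext => x; rewrite -{1}(k'K x) fK.
by subst k'; congr Automorphism; apply: Prop_irrelevance.
Qed.

Definition aut_one : automorphism M.
Proof. by exists id id. Defined.

Definition aut_mul g h : automorphism M.
Proof.
exists (g \o h) (aut_inv h \o aut_inv g).
- exact: can_comp (@aut_funK _ _ g) (@aut_funK _ _ h).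
- exact: can_comp (@aut_invK _ _ h) (@aut_invK _ _ g).
- by move=> f a /=; rewrite !aut_fint.
- by move=> r a; rewrite (aut_rint h) (aut_rint g).
Defined.

Definition aut_opp g : automorphism M.
Proof.
exists (aut_inv g) g.
- exact: aut_invK.
- exact: aut_funK.
- move=> f a; apply: (can_inj (@aut_funK _ _ g)); rewrite aut_invK aut_fint.
  by congr fint; apply/funext => i /=; rewrite aut_invK.
- move=> r a; rewrite (aut_rint g (_ \o _)).
  by rewrite (_ : g \o _ = a)//; apply/funext => i /=; rewrite aut_invK.
Defined.

Lemma aut_mulA : associative aut_mul.
Proof. by move=> g h k; apply: aut_ext. Qed.
Lemma aut_mul1 : left_id aut_one aut_mul.
Proof. by move=> g; apply: aut_ext. Qed.
Lemma aut_mulr1 : right_id aut_one aut_mul.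
Proof. by move=> g; apply: aut_ext. Qed.
Lemma aut_mulV : left_inverse aut_one aut_opp aut_mul.
Proof. by move=> g; apply: aut_ext => x /=; rewrite aut_funK. Qed.
Lemma aut_mulrV : right_inverse aut_one aut_opp aut_mul.
Proof. by move=> g; apply: aut_ext => x /=; rewrite aut_invK. Qed.

HB.instance Definition _ := isGroup.Build (automorphism M)
  aut_mulA aut_mul1 aut_mulr1 aut_mulV aut_mulrV.

End AutGroup.

(* The assignment sending the variables in V to the tuple a, and the
   parameters in P to their values under c. *)
Definition join_env (V P T : Type) (a : V -> T) (c : P -> T) (x : V + P) : T :=
  match x with inl v => a v | inr d => c d end.

(* Consistency with the elementary diagram of the parameters. *)
Definition finitely_satisfiable L (M : structure L) (V P : Type) (c : P -> M)
    (p : set (formula L (V + P))) :=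
  forall F : set (formula L (V + P)), finite_set F -> F `<=` p ->
    exists a : V -> M, forall phi, F phi -> sat phi (join_env a c).

(* A set of parameters has cardinality < (aleph_0 + lambda)^+ iff it has
   cardinality <= aleph_0 + lambda, where lambda = |I|. *)
Local Open Scope card_scope.
Definition small (I T : Type) (A : set T) := A #<= [set: nat + I].
Local Close Scope card_scope.

Definition saturated (I : Type) L (M : structure L) :=
  forall A : set M, small I A ->
  forall p : set (formula L (unit + A)),
    finitely_satisfiable (fun x : A => val x) p ->
    exists b : M,
      forall phi, p phi -> sat phi (join_env (fun=> b) (fun x : A => val x)).

Definition partial_elementary L (M : structure L) (A : set M) (h : A -> M) :=
  forall phi : formula L A, sat phi (fun x : A => val x : M) <-> sat phi h.

Definition strongly_homogeneous (I : Type) L (M : structure L) :=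
  forall A : set M, small I A ->
  forall h : A -> M, partial_elementary h ->
    exists g : automorphism M, forall x : A, g (val x) = h x.

Definition realizations L (M : structure L) (I : Type)
    (pi : set (formula L I)) : set (I -> M) :=
  [set a | forall phi, pi phi -> sat phi a].
Arguments realizations {L} M {I} pi.

(* S_X(M), where X is the set defined by the parameter-free type pi. *)
Record type_space L (I : Type) (pi : set (formula L I)) (M : structure L) :=
  TypeSpace {
    type_set : set (formula L (I + M));
    type_consistent : finitely_satisfiable (id : M -> M) type_set;
    type_complete : forall phi, type_set phi \/ type_set (Not phi);
    type_extends : forall phi, pi phi -> type_set (formula_map inl phi)
  }.

HB.instance Definition _ L (V : Type) := gen_eqMixin (formula L V).
HB.instance Definition _ L (V : Type) := gen_choiceMixin (formula L V).
HB.instance Definition _ L (V : Type) := isPointed.Build (formula L V) Bot.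

HB.instance Definition _ L (I : Type) (pi : set (formula L I)) M :=
  gen_eqMixin (type_space pi M).
HB.instance Definition _ L (I : Type) (pi : set (formula L I)) M :=
  gen_choiceMixin (type_space pi M).

HB.instance Definition _ L (I : Type) (pi : set (formula L I)) (M : structure L) :=
  @isSubBaseTopological.Build (type_space pi M) (formula L (I + M)) setT
    (fun phi => [set p | type_set p phi]).

Definition param_map (V P Q : Type) (h : P -> Q) (x : V + P) : V + Q :=
  match x with inl v => inl v | inr d => inr (h d) end.

Lemma eval_map L (V W : Type) (M : structure L) (h : V -> W) (e : W -> M) t :
  eval e (term_map h t) = eval (e \o h) t.
Proof. by elim: t => //= f a IH; congr fint; apply/funext. Qed.

Lemma sat_map L (V W : Type) (M : structure L) (h : V -> W) (phi : formula L V)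
    (e : W -> M) :
  sat (formula_map h phi) e <-> sat phi (e \o h).
Proof.
elim: phi W h e => {V} [//|V s t|V r a|V p IHp q IHq|V p IH] W h e /=.
- by rewrite !eval_map.
- rewrite (_ : (fun i => eval e (term_map h (a i))) =
               (fun i => eval (e \o h) (a i)))//.
  by apply/funext => i; rewrite eval_map.
- by rewrite IHp IHq.
- have E (x : M) : env_cons x e \o omap h = env_cons x (e \o h).
    by apply/funext => -[].
  by split=> H x; have := H x; rewrite IH E.
Qed.

Lemma type_ext L (I : Type) (pi : set (formula L I)) (M : structure L)
    (p q : type_space pi M) :
  (forall phi, type_set p phi <-> type_set q phi) -> p = q.
Proof.
case: p => p p1 p2 p3; case: q => q q1 q2 q3 /= H.
have E : p = q by apply/seteqP; split => x /H.
by subst q; congr TypeSpace; apply: Prop_irrelevance.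
Qed.

Lemma formula_map_comp L (U V W : Type) (h : U -> V) (k : V -> W) (phi : formula L U) :
  formula_map k (formula_map h phi) = formula_map (k \o h) phi.
Proof.
have T (X Y Z : Type) (h' : X -> Y) (k' : Y -> Z) (t : term L X) :
    term_map k' (term_map h' t) = term_map (k' \o h') t.
  by elim: t => //= f a IH; congr App; apply/funext.
elim: phi V W h k => {U} [//|U s t|U r a|U p IHp q IHq|U p IH] V W h k /=.
- by rewrite !T.
- by congr Rel; apply/funext => i; rewrite T.
- by rewrite IHp IHq.
- by rewrite IH; congr (All (formula_map _ _)); apply/funext => -[].
Qed.

Lemma formula_map_id L (V : Type) (phi : formula L V) : formula_map id phi = phi.
Proof.
have T (X : Type) (t : term L X) : term_map id t = t.
  by elim: t => //= f a IH; congr App; apply/funext.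
elim: phi => {V} [//|V s t|V r a|V p IHp q IHq|V p IH] /=.
- by rewrite !T.
- by congr Rel; apply/funext => i; rewrite T.
- by rewrite IHp IHq.
- by rewrite (_ : omap id = id) ?IH//; apply/funext => -[].
Qed.

Lemma aut_elementary L (M : structure L) (g : automorphism M) :
  elementary g.
Proof.
have T (V : Type) (e : V -> M) t : g (eval e t) = eval (g \o e) t.
  elim: t => //= f a IH; rewrite aut_fint; congr fint.
  by apply/funext => i /=; rewrite IH.
move=> V; elim=> {V} [//|V s t|V r a|V p IHp q IHq|V p IH] e /=.
- by rewrite -!T; split=> [->//|/(can_inj (@aut_funK _ _ g))].
- rewrite (aut_rint g) (_ : g \o _ = (fun i => eval (g \o e) (a i)))//.
  by apply/funext => i /=; rewrite T.
- by rewrite IHp IHq.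
- have E (x : M) : g \o env_cons x e = env_cons (g x) (g \o e).
    by apply/funext => -[].
  split=> H x; last by rewrite IH E.
  by rewrite -(aut_invK g x) -E -IH.
Qed.

Lemma finitely_satisfiable_param L (M : structure L) (V P Q : Type) (h : P -> Q)
    (c : Q -> M) (p : set (formula L (V + Q))) :
  finitely_satisfiable c p ->
  finitely_satisfiable (c \o h) (formula_map (param_map h) @^-1` p).
Proof.
move=> fs F finF Fp.
have [||a Ha] := fs (formula_map (param_map h) @` F).
- exact: finite_image.
- by move=> _ [phi /Fp ? <-].
- exists a => phi Fphi.
  have /sat_map := Ha (formula_map (param_map h) phi) (ex_intro2 _ _ _ Fphi erefl).
  by rewrite (_ : _ \o _ = join_env a (c \o h))//; apply/funext => -[].
Qed.

Section Action.
Variables (L : language) (I : Type) (pi : set (formula L I)).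
Variables (M : structure L).

Section ActOn.
Variables (g : automorphism M) (p : type_space pi M).

(* psi(x, b) is in g p iff psi(x, g^-1 b) is in p; that is,
   g p = {phi(x, g a) : phi(x, a) in p}. *)
Let act_set : set (formula L (I + M)) :=
  formula_map (param_map (aut_inv g)) @^-1` type_set p.

Lemma type_act_consistent : finitely_satisfiable (id : M -> M) act_set.
Proof.
move=> F finF Fp.
have [a Ha] := finitely_satisfiable_param (h := aut_inv g)
  (@type_consistent _ _ _ _ p) finF Fp.
exists (g \o a) => phi /Ha; rewrite (aut_elementary g).
rewrite (_ : _ \o join_env _ _ = join_env (g \o a) id)//.
by apply/funext => -[//|x] /=; rewrite aut_invK.
Qed.

Lemma type_act_complete phi : act_set phi \/ act_set (Not phi).
Proof. exact: (@type_complete _ _ _ _ p). Qed.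

Lemma type_act_extends phi : pi phi -> act_set (formula_map inl phi).
Proof.
move=> /(@type_extends _ _ _ _ p).
by rewrite /act_set /preimage/= formula_map_comp.
Qed.

Definition type_act : type_space pi M :=
  TypeSpace type_act_consistent type_act_complete type_act_extends.

End ActOn.

Lemma type_act1 p : type_act 1%g p = p.
Proof.
apply: type_ext => phi /=; rewrite /preimage/=.
rewrite (_ : param_map _ = id) ?formula_map_id//.
by apply/funext => -[].
Qed.

Lemma type_actM g h p : type_act (g * h)%g p = type_act g (type_act h p).
Proof.
apply: type_ext => phi /=; rewrite /preimage/= formula_map_comp.
by rewrite (_ : param_map _ = param_map (aut_inv h) \o param_map (aut_inv g))//;
  apply/funext => -[].
Qed.

End Action.

Definition Ex L (V : Type) (phi : formula L (option V)) : formula L V :=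
  Not (All (Not phi)).

Lemma sat_Ex L (V : Type) (M : structure L) (phi : formula L (option V)) (e : V -> M) :
  sat (Ex phi) e <-> exists x : M, sat phi (env_cons x e).
Proof.
split=> /= [H|[x Hx] H]; last exact: (H x).
by apply: contra_notP H => H x Hx; apply: H; exists x.
Qed.

Fixpoint conj_seq L (V : Type) (s : seq (formula L V)) : formula L V :=
  if s is phi :: s' then Not (Imp phi (Not (conj_seq s'))) else Not Bot.

Lemma sat_conj_seq L (V : Type) (M : structure L) (s : seq (formula L V)) (e : V -> M) :
  sat (conj_seq s) e <-> forall phi, phi \in s -> sat phi e.
Proof.
elim: s => [|phi s IH] /=; first by split.
split=> [H psi|H K].
  rewrite in_cons => /orP[/eqP ->|ps].
    by apply: contrapT => n; apply: H => /n.
  by apply: contrapT => n; apply: H => _ /IH /(_ psi ps).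
apply: K; first by apply: H; rewrite mem_head.
by apply/IH => psi ps; apply: H; rewrite in_cons ps orbT.
Qed.

Lemma eval_finite L (V : Type) (t : term L V) : exists s : seq V,
  forall (M : structure L) (e e' : V -> M),
    (forall v, List.In v s -> e v = e' v) -> eval e t = eval e' t.
Proof.
elim: t => [v|f a IH]; first by exists [:: v] => M e e' H; apply: H; left.
have /choice[s Hs] := IH.
exists (flatten [seq s i | i <- enum 'I_(farity f)]) => M e e' H /=.
congr fint; apply/funext => i; apply: Hs => v vi; apply: H.
have := mem_enum 'I_(farity f) i; rewrite inE.
elim: (enum _) => //= k r IHr; rewrite in_cons => /orP[/eqP <-|ir];
  apply: List.in_or_app; [by left|by right; apply: IHr].
Qed.

Lemma sat_finite L (V : Type) (phi : formula L V) : exists s : seq V,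
  forall (M : structure L) (e e' : V -> M),
    (forall v, List.In v s -> e v = e' v) -> sat phi e <-> sat phi e'.
Proof.
elim: phi => {V} [V|V t u|V r a|V p [s Hs] q [s' Hs']|V p [s Hs]].
- by exists [::].
- have [s Hs] := eval_finite t; have [s' Hs'] := eval_finite u.
  exists (s ++ s') => M e e' H /=.
  rewrite (Hs M e e') ?(Hs' M e e')// => v vs; apply: H;
    apply: List.in_or_app; [by right|by left].
- have /choice[s Hs] := fun i => eval_finite (a i).
  exists (flatten [seq s i | i <- enum 'I_(rarity r)]) => M e e' H /=.
  rewrite (_ : (fun i => eval e (a i)) = (fun i => eval e' (a i)))//.
  apply/funext => i; apply: Hs => v vi; apply: H.
  have := mem_enum 'I_(rarity r) i; rewrite inE.
  elim: (enum _) => //= k l IHl; rewrite in_cons => /orP[/eqP <-|il];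
    apply: List.in_or_app; [by left|by right; apply: IHl].
- exists (s ++ s') => M e e' H /=.
  rewrite (Hs M e e') ?(Hs' M e e')// => v vs; apply: H;
    apply: List.in_or_app; [by right|by left].
- exists (pmap id s) => M e e' H /=.
  have E (x : M) : sat p (env_cons x e) <-> sat p (env_cons x e').
    apply: Hs => -[v|//] vs /=; apply: H.
    elim: s vs => //= o s IH [->|vs] /=; first by left.
    by case: o => [w|] /=; [right|]; apply: IH.
  by split=> K x; apply/E.
Qed.

Lemma elementary_solution L (M N : structure L) (j : M -> N) (V : Type)
    (phi : formula L (V + M)) (a : V -> N) :
  elementary j -> sat phi (join_env a j) ->
  exists b : V -> M, sat phi (join_env b id).
Proof.
move=> hj sphi.
pose bind (v : V) (w : V + M) : option (V + M) :=
  if pselect (w = inl v) then None else Some w.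
have [s Hs] := sat_finite phi.
pose vs : seq V := pmap (fun w => if w is inl v then Some v else None) s.
pose close := foldr (fun v (psi : formula L (V + M)) => Ex (formula_map (bind v) psi)).
have closeE (K : structure L) (psi : formula L (V + M)) (e : V + M -> K) r :
    sat (close psi r) e <->
    exists e', (forall w, (forall v, List.In v r -> w <> inl v) -> e' w = e w)
               /\ sat psi e'.
  elim: r e => [|v r IH] e /=.
    split=> [H|[e' [E H]]]; first by exists e.
    suff <- : e' = e by [].
    by apply/funext => w; apply: E.
  change (sat (Ex (formula_map (bind v) (close psi r))) e <->
    exists e', (forall w, (forall v0, v = v0 \/ List.In v0 r -> w <> inl v0) ->
      e' w = e w) /\ sat psi e').
  rewrite sat_Ex; split=> [[x /sat_map /IH [e' [E H]]]|[e' [E H]]].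
    exists e'; split=> // w nw; rewrite E; last first.
      by move=> u ur; apply: nw; right.
    rewrite /= /bind; case: pselect => //= ew.
    by have := nw v (or_introl erefl).
  exists (e' (inl v)); apply/sat_map/IH; exists e'; split=> // w nw /=.
  rewrite /bind; case: pselect => [ewv|nwv] /=; first by rewrite ewv.
  by apply: E => u [<-//|]; apply: nw.
have [m0] := carrier_inhabited M.
have : sat (close phi vs) (j \o join_env (fun=> m0) id).
  apply/closeE.
  pose e' (w : V + M) : N := match w with
    | inr m => j m
    | inl v => if pselect (List.In v vs) then a v else j m0 end.
  exists e'; split.
    move=> [v|//] nw /=; case: pselect => // vin.
    by have := nw v vin.
  apply/(Hs N e' (join_env a j)); last exact: sphi.
  move=> -[v|//] vin /=; case: pselect => //; case.
  rewrite /vs; elim: s vin {Hs vs e'} => //= w s IH [->|vin] /=; first by left.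
  by case: w => [w|w] /=; [right|]; apply: IH.
rewrite -(hj _ _ (join_env (fun=> m0) id)) => /closeE[e' [E H]].
exists (e' \o inl); rewrite (_ : join_env _ _ = e')//.
by apply/funext => -[//|m] /=; rewrite E.
Qed.

Section Restriction.
Variables (L : language) (I : Type) (pi : set (formula L I)).
Variables (M N : structure L) (j : M -> N) (hj : elementary j).
Variable p : type_space pi N.

Let restr_set : set (formula L (I + M)) :=
  formula_map (param_map j) @^-1` type_set p.

Lemma type_restr_consistent : finitely_satisfiable (id : M -> M) restr_set.
Proof.
move=> F finF Fp.
have [a Ha] := finitely_satisfiable_param (h := j)
  (@type_consistent _ _ _ _ p) finF Fp.
have [s Es] : exists s : seq (formula L (I + M)), F = [set` s].
  by move/finite_seqP: finF.
have [|b /sat_conj_seq Hb] :=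
  @elementary_solution _ _ _ _ _ (conj_seq s) a hj.
  by apply/sat_conj_seq => phi ps; apply: Ha; rewrite Es.
by exists b => phi; rewrite Es => /Hb.
Qed.

Lemma type_restr_complete phi : restr_set phi \/ restr_set (Not phi).
Proof. exact: (@type_complete _ _ _ _ p). Qed.

Lemma type_restr_extends phi : pi phi -> restr_set (formula_map inl phi).
Proof.
move=> /(@type_extends _ _ _ _ p).
by rewrite /restr_set /preimage/= formula_map_comp.
Qed.

Definition type_restr : type_space pi M :=
  TypeSpace type_restr_consistent type_restr_complete type_restr_extends.

End Restriction.

Section Tame.
Variables (R : realType) (G : groupType) (Y : topologicalType).
Implicit Types (act : G -> Y -> Y) (f : Y -> R).

Definition translate act (g : G) f : Y -> R := fun y => f (act g^-1%g y).

Definition independent (u : nat -> Y -> R) :=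
  exists r s : R, (r < s)%R /\
    forall P M : set nat, finite_set P -> finite_set M -> [disjoint P & M] ->
      (\bigcap_(n in P) (u n @^-1` `]-oo, r[)) `&`
      (\bigcap_(n in M) (u n @^-1` `]s, +oo[)) !=set0.

Definition tame_fun act f :=
  ~ exists u : nat -> Y -> R,
      (forall n, range (translate act ^~ f) (u n)) /\ independent u.

Definition tame_flow act := forall f, continuous f -> tame_fun act f.

End Tame.

Section TameQuotient.
Variables (R : realType) (G : groupType) (Y : topologicalType).
Variable (act : G -> Y -> Y).
Local Open Scope quotient_scope.

Definition rel_graph (E : equiv_rel Y) : set (Y * Y) :=
  [set xy | E xy.1 xy.2].

Definition quotient_flow (E : equiv_rel Y) : topologicalType :=
  quotient_topology {eq_quot E}.

(* The action g [y] = [g y]; it does not depend on the choice of the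
   representative when E is invariant. *)
Definition quotient_act (E : equiv_rel Y) (g : G) (q : quotient_flow E) :
    quotient_flow E :=
  \pi_(quotient_topology {eq_quot E}) (act g (repr q)).

Definition invariant_rel (E : equiv_rel Y) :=
  forall g x y, E x y -> E (act g x) (act g y).

Definition tame_rel (E : equiv_rel Y) :=
  [/\ closed (rel_graph E), invariant_rel E
    & tame_flow R (@quotient_act E)].

Definition finest_tame_rel (F : equiv_rel Y) :=
  tame_rel F /\ forall E, tame_rel E -> rel_graph F `<=` rel_graph E.

End TameQuotient.

Definition is_F_Tame (R : realType) L (I : Type) (pi : set (formula L I))
    (M : structure L) (F : equiv_rel (type_space pi M)) :=
  finest_tame_rel R (@type_act _ _ pi M) F.

(* Main.v *)
(* Write C and C' for the two models, Y and Y' for the spaces of types over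
   them, and r : Y' -> Y for the restriction.  By saturation of C there is an
   ultrafilter U on the maps h : C' -> C such that, for any countable tuples b
   of C and c of C', U-almost every h fixes b and sends c to a tuple of the same
   type.  The limit sec p = {phi(x, c) : phi(x, h c) in p for U-almost every h}
   is then a (usually discontinuous) section of r.  By homogeneity, if phi(x, c)
   and psi(x, c) belong to sec p and sec q, then for almost every h some
   automorphism of C' carries c to h c; hence a closed invariant relation
   contains (sec p, sec q) as soon as it contains suitable pairs of types
   containing phi(x, h c) and psi(x, h c).

   It follows that r[F'_Tame] is the preimage of F'_Tame under sec, and that it
   is closed and invariant.  It is tame since a continuous function on Y is
   controlled by formulas, and automorphisms of C are matched on finite tuples
   by automorphisms of C'.  So F_Tame is contained in r[F'_Tame].

   Conversely, let E' be the largest invariant relation on Y' that r maps into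
   F_Tame; it is closed and contains (sec p, sec q) for every (p, q) in F_Tame.
   It is tame: a continuous E'-invariant function f on Y' only depends on a
   countable tuple of parameters, which an automorphism k moves into C.  Then
   f(k^-1 sec p) is continuous and F_Tame-invariant in p, and an independent
   sequence of translates of f would, after moving countably many parameters
   into C, give one for this function.  So F'_Tame is contained in E'. *)

Require Import Defs.
From mathcomp Require finmap.
From HB Require Import structures.
From mathcomp Require Import all_boot all_order all_algebra.
From mathcomp Require Import all_classical all_reals all_analysis.
Set Implicit Arguments.
Unset Strict Implicit.
Unset Printing Implicit Defensive.
Import Order.TTheory GRing.Theory Num.Theory numFieldNormedType.Exports.
Local Open Scope classical_set_scope.


(** * Tuples of the same type, homogeneity and saturation *)

Definition same_type L (V : Type) (M N : structure L) (c : V -> M) (d : V -> N) :=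
  forall phi : formula L V, sat phi c <-> sat phi d.

Lemma same_type_sym L (V : Type) (M N : structure L) (c : V -> M) (d : V -> N) :
  same_type c d -> same_type d c.
Proof. by move=> H phi; split=> /H. Qed.

Lemma same_type_trans L (V : Type) (M N K : structure L) (c : V -> M)
    (d : V -> N) (e : V -> K) :
  same_type c d -> same_type d e -> same_type c e.
Proof. by move=> H1 H2 phi; rewrite H1. Qed.

Lemma same_type_comp L (U V : Type) (M N : structure L) (c : V -> M)
    (d : V -> N) (s : U -> V) :
  same_type c d -> same_type (c \o s) (d \o s).
Proof. by move=> H phi; rewrite -(sat_map s phi c) -(sat_map s phi d). Qed.

Lemma elementary_same_type L (V : Type) (M N : structure L) (j : M -> N)
    (c : V -> M) :
  elementary j -> same_type (j \o c) c.
Proof. by move=> hj phi; rewrite -(hj _ phi c). Qed.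

Lemma same_type_eq L (V : Type) (M N : structure L) (c : V -> M) (d : V -> N) v w :
  same_type c d -> c v = c w -> d v = d w.
Proof. by move=> /(_ (Eq (Var v) (Var w))) /= H /H. Qed.

(** Homogeneity and saturation speak of parameter sets; [range_index] and [to_range] translate them
    to tuples, which may repeat values. *)
Definition range_index (V T : Type) (c : V -> T) (x : range c) : V :=
  sval (cid2 (set_valP x)).

Lemma range_indexK (V T : Type) (c : V -> T) (x : range c) :
  c (range_index x) = val x.
Proof. by rewrite /range_index; case: cid2. Qed.

Definition to_range (V T : Type) (c : V -> T) (v : V) : range c :=
  SigSub (mem_set (ex_intro2 _ _ v Logic.I erefl : range c (c v))).

Lemma small_range (I T : Type) (V : countType) (c : V -> T) : small I (range c).
Proof.
rewrite /small.
apply: (@card_le_trans _ _ _ [set: V]); first exact: card_image_le.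
apply: (card_le_trans (countableP [set: V])).
rewrite (_ : [set: nat] = (fun w : nat + I => if w is inl n then n else 0) @` setT).
  exact: card_image_le.
by apply/seteqP; split => // n _; exists (inl n).
Qed.

Lemma homogeneous_tuples I L (M : structure L) (V : countType) (c d : V -> M) :
  strongly_homogeneous I M -> same_type c d ->
  exists g : automorphism M, forall v, g (c v) = d v.
Proof.
move=> homM cd.
have [|g Hg] := homM _ (small_range I c) (d \o @range_index _ _ c).
  move=> phi.
  rewrite (_ : (fun x : range c => val x) = c \o @range_index _ _ c).
    exact: same_type_comp.
  by apply/funext => x /=; rewrite range_indexK.
exists g => v; have -> := Hg (to_range c v).
by apply: (same_type_eq cd); rewrite range_indexK.
Qed.

(** The type of [y] over [c], with parameters moved to [a], is finitely satisfiable because [a]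
    satisfies the same existential formulas as [c]. *)
Lemma saturated_extend I L (M N : structure L) (V : countType)
    (a : V -> M) (c : V -> N) (y : N) :
  saturated I M -> same_type a c ->
  exists x : M, same_type (env_cons x a) (env_cons y c).
Proof.
move=> satM ac.
pose ix := @range_index _ _ a.
pose p : set (formula L (unit + range a)) :=
  [set psi | sat psi (join_env (fun=> y) (c \o ix))].
have [|x Hx] := satM _ (small_range I a) p.
  move=> F /finite_seqP[s ->] sp.
  pose m (w : unit + range a) : option V :=
    match w with inl _ => None | inr r => Some (ix r) end.
  have : sat (Ex (formula_map m (conj_seq s))) c.
    apply/sat_Ex; exists y; apply/sat_map/sat_conj_seq => phi /sp.
    rewrite /p /= (_ : join_env _ _ = env_cons y c \o m)//.
    by apply/funext => -[].
  rewrite -(ac _) => /sat_Ex[x /sat_map /sat_conj_seq Hx].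
  exists (fun=> x) => phi /Hx.
  rewrite (_ : join_env _ _ = env_cons x a \o m)//.
  by apply/funext => -[//|r] /=; rewrite range_indexK.
exists x.
pose m (o : option V) : unit + range a :=
  if o is Some v then inr (to_range a v) else inl tt.
have xE : env_cons x a = join_env (fun=> x) (fun r : range a => val r) \o m.
  by apply/funext => -[].
have yE : env_cons y c = join_env (fun=> y) (c \o ix) \o m.
  apply/funext => -[v|//] /=; apply: (same_type_eq ac).
  by rewrite range_indexK.
suff imp phi : sat phi (env_cons y c) -> sat phi (env_cons x a).
  move=> phi; split; last exact: imp.
  by move=> sx; apply: contrapT => sy; exact: (imp (Not phi) sy sx).
by rewrite xE yE => /sat_map H; apply/sat_map; exact: Hx.
Qed.

(** The terms of [c] are realized one at a time: [b] and the finitely many values found so far form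
    a countable tuple, to which [saturated_extend] applies. *)
Lemma saturated_realize I L (M N : structure L) (j : M -> N)
    (b : nat -> M) (c : nat -> N) :
  elementary j -> saturated I M ->
  exists a : nat -> M, same_type (join_env b a) (join_env (j \o b) c).
Proof.
move=> hj satM; pose m0 := b 0.
(* Positions past the end of a list hold [m0] or [j m0], so every stage uses the same variables. *)
pose ok n (l : seq M) :=
  same_type (join_env b (nth m0 l)) (join_env (j \o b) (nth (j m0) (mkseq c n))).
have step (nl : nat * seq M) : exists x : M,
    size nl.2 = nl.1 -> ok nl.1 nl.2 -> ok nl.1.+1 (rcons nl.2 x).
  case: nl => n l /=.
  have [[sl okl]|nok] := pselect (size l = n /\ ok n l); last first.
    by exists m0 => sl okl; case: nok.
  have [x Hx] := saturated_extend (c n) satM okl; exists x => _ _.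
  pose s (w : nat + nat) : option (nat + nat) :=
    if w == inr n then None else Some w.
  have /= := same_type_comp s Hx; congr (same_type _ _);
    apply/funext => -[k|k]; rewrite /s //=.
  - rewrite nth_rcons sl (_ : (inr k == inr n :> nat + nat) = (k == n))//.
    case: ltngtP => //= h; rewrite nth_default// sl; exact: ltnW.
  - rewrite (_ : (inr k == inr n :> nat + nat) = (k == n))//.
    rewrite mkseqS nth_rcons size_mkseq.
    by case: ltngtP => //= h; rewrite nth_default// size_mkseq ltnW.
have [ch Hch] := choice step.
pose l := fix l n := if n is k.+1 then rcons (l k) (ch (k, l k)) else [::].
pose a n := ch (n, l n).
have lE n : l n = mkseq a n by elim: n => //= n IH; rewrite mkseqS -IH.
have okl n : ok n (l n).
  elim: n => [|n IH] /=; last by apply: Hch => //=; rewrite lE size_mkseq.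
  rewrite /ok /=.
  have := same_type_sym (elementary_same_type (join_env b (fun _ : nat => m0)) hj).
  by congr (same_type _ _); apply/funext => -[k|k] //=; rewrite nth_nil.
exists a => phi.
have [s Hs] := sat_finite phi.
(* [n] exceeds every index of [c] that occurs in [phi], so stage [n] already decides [phi]. *)
pose n := (\max_(w <- s) (if w is inr k then k else 0)%N).+1.
have sn k : List.In (inr k) s -> (k < n)%N.
  rewrite /n ltnS; elim: (s) => //= w r IH [->|/IH kr]; rewrite big_cons.
    exact: leq_maxl.
  by rewrite leq_max kr orbT.
rewrite (Hs _ _ (join_env b (nth m0 (l n)))); last first.
  by move=> [//|k] /sn kn; rewrite lE /join_env nth_mkseq.
rewrite (okl n phi).
by apply: Hs => -[//|k] /sn kn; rewrite /join_env nth_mkseq.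
Qed.

(** * Substitution of parameters and finite supports *)

Lemma term_map_finite L (V : Type) (t : term L V) : exists s : seq V,
  forall (W : Type) (h k : V -> W),
    (forall v, List.In v s -> h v = k v) -> term_map h t = term_map k t.
Proof.
elim: t => [v|f a IH].
  by exists [:: v] => W h k H /=; rewrite H//; left.
have /choice[s Hs] := IH.
exists (flatten [seq s i | i <- enum 'I_(farity f)]) => W h k H /=.
congr App; apply/funext => i; apply: Hs => v vi; apply: H.
have := mem_enum 'I_(farity f) i; rewrite inE.
elim: (enum _) => //= n r IHr; rewrite in_cons => /orP[/eqP <-|ir];
  apply: List.in_or_app; [by left|by right; apply: IHr].
Qed.

Lemma formula_map_finite L (V : Type) (phi : formula L V) : exists s : seq V,
  forall (W : Type) (h k : V -> W),
    (forall v, List.In v s -> h v = k v) -> formula_map h phi = formula_map k phi.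
Proof.
elim: phi => {V} [V|V t u|V r a|V p [s Hs] q [s' Hs']|V p [s Hs]].
- by exists [::].
- have [s Hs] := term_map_finite t; have [s' Hs'] := term_map_finite u.
  exists (s ++ s') => W h k H /=.
  rewrite (Hs W h k) ?(Hs' W h k)// => v vs; apply: H;
    apply: List.in_or_app; [by right|by left].
- have /choice[s Hs] := fun i => term_map_finite (a i).
  exists (flatten [seq s i | i <- enum 'I_(rarity r)]) => W h k H /=.
  congr Rel; apply/funext => i; apply: Hs => v vi; apply: H.
  have := mem_enum 'I_(rarity r) i; rewrite inE.
  elim: (enum _) => //= n l IHl; rewrite in_cons => /orP[/eqP <-|il];
    apply: List.in_or_app; [by left|by right; apply: IHl].
- exists (s ++ s') => W h k H /=.
  rewrite (Hs W h k) ?(Hs' W h k)// => v vs; apply: H;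
    apply: List.in_or_app; [by right|by left].
- exists (pmap id s) => W h k H /=; congr All.
  apply: Hs => -[v|//] vs /=; congr Some; apply: H.
  elim: s vs => //= o s IH [->|vs] /=; first by left.
  by case: o => [w|] /=; [right|]; apply: IH.
Qed.

Definition subst L (I P Q : Type) (h : P -> Q) (phi : formula L (I + P)) :
  formula L (I + Q) := formula_map (param_map h) phi.

Lemma subst_comp L (I P Q S : Type) (h : P -> Q) (k : Q -> S)
    (phi : formula L (I + P)) :
  subst k (subst h phi) = subst (k \o h) phi.
Proof.
rewrite /subst formula_map_comp; congr formula_map.
by apply/funext => -[].
Qed.

Lemma subst_id L (I P : Type) (phi : formula L (I + P)) : subst id phi = phi.
Proof.
rewrite /subst (_ : param_map id = id) ?formula_map_id//.
by apply/funext => -[].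
Qed.

Lemma sat_subst L (M : structure L) (I P Q : Type) (h : P -> Q)
    (phi : formula L (I + P)) (a : I -> M) (c : Q -> M) :
  sat (subst h phi) (join_env a c) <-> sat phi (join_env a (c \o h)).
Proof.
rewrite /subst sat_map (_ : _ \o _ = join_env a (c \o h))//.
by apply/funext => -[].
Qed.

(** Each formula has finitely many parameters, so one sequence, indexed through [pickle (v, i)],
    lists those of countably many formulas. *)
Lemma subst_support L (I : Type) (M : structure L) (V : countType)
    (phi : V -> formula L (I + M)) :
  exists c : nat -> M, forall v (Q : Type) (h k : M -> Q),
    (forall n, h (c n) = k (c n)) -> subst h (phi v) = subst k (phi v).
Proof.
have [m0] := carrier_inhabited M.
have /choice[s Hs] := fun v => formula_map_finite (phi v).
pose par (w : I + M) : M := if w is inr m then m else m0.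
pose c n := if unpickle n is Some (v, k) then nth m0 (map par (s v)) k else m0.
exists c => v Q h k H; apply: Hs => -[//|m] min /=; congr inr.
suff [n <-] : exists n, c n = m by [].
have [i Hi] : exists i, nth m0 (map par (s v)) i = m.
  elim: (s v) min => //= w l IH [->|/IH[i Hi]]; first by exists 0%N.
  by exists i.+1.
by exists (pickle (v, i)); rewrite /c pickleK.
Qed.

(** * The topology of the type space *)

Section TypeSpaceTopology.
Variables (L : language) (I : Type) (pi : set (formula L I)) (M : structure L).
Implicit Types (p q : type_space pi M) (phi psi : formula L (I + M)).

(** Otherwise [p] contains [Not psi], and a tuple realizing it together with [s] contradicts the
    entailment. *)
Lemma type_entails p (s : seq (formula L (I + M))) psi :
  (forall phi, phi \in s -> type_set p phi) ->
  (forall a : I -> M, (forall phi, phi \in s -> sat phi (join_env a id)) ->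
    sat psi (join_env a id)) ->
  type_set p psi.
Proof.
move=> sp ent; have [//|npsi] := type_complete p psi.
have [|phi|a Ha] := @type_consistent _ _ _ _ p [set` Not psi :: s].
- exact: finite_seq.
- by rewrite /= in_cons => /orP[/eqP ->//|/sp].
- exfalso; apply: (Ha (Not psi)); first by rewrite /= mem_head.
  by apply: ent => phi ps; apply: Ha; rewrite /= in_cons ps orbT.
Qed.

Lemma type_bot p : ~ type_set p Bot.
Proof.
move=> pb; have [|_ ->//|a] := @type_consistent _ _ _ _ p [set Bot].
- exact: finite_set1.
- by move=> /(_ Bot erefl).
Qed.

Lemma type_not p phi : type_set p (Not phi) <-> ~ type_set p phi.
Proof.
split=> [np pp|npp]; last by have [] := type_complete p phi.
apply: (@type_bot p); apply: (@type_entails p [:: phi; Not phi]) => [chi|a H].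
  by rewrite !inE => /orP[] /eqP ->.
have /= h : sat (Not phi) (join_env a id) by apply: H; rewrite !inE eqxx orbT.
by apply: h; apply: H; rewrite mem_head.
Qed.

Lemma type_conj p (s : seq (formula L (I + M))) :
  type_set p (conj_seq s) <-> (forall phi, phi \in s -> type_set p phi).
Proof.
split=> [ps phi phis|ps]; last first.
  by apply: (type_entails ps) => a H; apply/sat_conj_seq.
apply: (@type_entails p [:: conj_seq s]) => [chi|a H].
  by rewrite inE => /eqP ->.
by have /sat_conj_seq := H (conj_seq s) (mem_head _ _); apply.
Qed.

(** Basic open sets are finite intersections of subbasic ones, and a conjunction turns these into
    one formula. *)
Lemma type_nbhsP p (A : set (type_space pi M)) :
  nbhs p A <-> exists phi, type_set p phi /\ forall q, type_set q phi -> A q.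
Proof.
split=> [|[phi [pphi HA]]]; rewrite nbhsE /=.
  move=> [B [[D fD <-] [b Db bp]] BA].
  have [S _ SE] := fD b Db.
  exists (conj_seq (finmap.enum_fset S)); split.
    have {}bp : b p := bp.
    by apply/type_conj => phi phiS; move: bp; rewrite -SE; apply.
  move=> q /type_conj qS; apply: BA; exists b => //.
  suff : b q by [].
  by rewrite -SE => phi phiS; apply: qS.
exists [set q | type_set q phi]; last by move=> q /HA.
split=> //; exists [set [set q | type_set q phi]]; last by rewrite bigcup_set1.
move=> _ ->; exists (finmap.fset1 phi) => //.
  by move=> ? _; rewrite inE.
apply/seteqP; split=> q /=; first by apply; rewrite /= inE.
by move=> H psi; rewrite /= inE => /eqP ->.
Qed.

Lemma closed_relP (E : equiv_rel (type_space pi M)) :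
  closed (rel_graph E) <->
  forall p q, (forall phi psi, type_set p phi -> type_set q psi ->
    exists p' q', [/\ type_set p' phi, type_set q' psi & E p' q']) -> E p q.
Proof.
split=> [cE p q H|H [p q] /= cl].
  apply: (cE (p, q)) => A [[A1 A2] /= [/type_nbhsP[phi [pphi H1]]
    /type_nbhsP[psi [qpsi H2]]]] HA.
  have [p' [q' [p'phi q'psi Epq]]] := H phi psi pphi qpsi.
  by exists (p', q'); split=> //; apply: HA; split; [apply: H1|apply: H2].
apply: H => phi psi pphi qpsi.
have [|[p' q'] [/= Epq [/= ? ?]]] :=
  cl ([set r | type_set r phi] `*` [set r | type_set r psi]).
  exists ([set r | type_set r phi], [set r | type_set r psi]) => //.
  by split; apply/type_nbhsP; [exists phi|exists psi].
by exists p', q'.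
Qed.

(** An ultrafilter on types converges to the set of formulas that belong to almost every type. *)
Lemma type_space_compact : compact [set: type_space pi M].
Proof.
rewrite compact_ultra => U UU _.
pose l : set (formula L (I + M)) := [set phi | U [set p | type_set p phi]].
have lfin (s : seq (formula L (I + M))) : (forall phi, phi \in s -> l phi) ->
    U [set p | forall phi, phi \in s -> type_set p phi].
  elim: s => [_|phi s IH Hs]; first by apply: filterS filterT.
  have h1 := Hs phi (mem_head _ _).
  have h2 : U [set p | forall phi, phi \in s -> type_set p phi].
    by apply: IH => psi ps; apply: Hs; rewrite in_cons ps orbT.
  apply: filterS (filterI h1 h2) => p [p1 p2] psi.
  by rewrite in_cons => /orP[/eqP ->|/p2].
have lc : finitely_satisfiable (id : M -> M) l.
  move=> F /finite_seqP[s ->] /lfin /filter_ex[p ps].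
  apply: (@type_consistent _ _ _ _ p); first exact: finite_seq.
  exact: ps.
have lcpl phi : l phi \/ l (Not phi).
  have [|] := in_ultra_setVsetC [set p | type_set p phi] UU; first by left.
  by move=> H; right; apply: filterS H => p /type_not.
have lext (phi : formula L I) : pi phi -> l (formula_map inl phi).
  by move=> pphi; apply: filterS filterT => p _; apply: type_extends.
exists (TypeSpace lc lcpl lext); split=> // A /type_nbhsP[phi [lphi HA]].
exact: filterS lphi.
Qed.

Variable R : realType.
Implicit Types f : type_space pi M -> R.
Local Open Scope ring_scope.

(** By compactness: if no formula separates, the sets [B phi] with [D phi] generate a proper filter.
    A cluster point [p0] has [f p0 <= u], so some [phi] in [p0] satisfies [D phi], and the
    neighbourhood it defines misses [B phi]. *)
Lemma continuous_separation f (u v : R) : continuous f -> u < v ->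
  exists phi, (forall p, f p < u -> type_set p phi) /\
              (forall p, type_set p phi -> f p < v).
Proof.
move=> cf uv; apply: contrapT => nophi.
pose D phi := forall p, type_set p phi -> f p < v.
pose B phi : set (type_space pi M) := [set p | f p < u /\ ~ type_set p phi].
have Bne phi : D phi -> B phi !=set0.
  move=> Dphi; apply: contrapT => nB; apply: nophi; exists phi; split=> // p fp.
  by apply: contrapT => np; apply: nB; exists p.
pose Fi : set_system (type_space pi M) := filter_from D B.
have FF : ProperFilter Fi.
  apply: filter_from_proper; last exact: Bne.
  apply: filter_from_filter => [|phi psi Dphi Dpsi].
    by exists Bot => p /type_bot.
  (* The disjunction of [phi] and [psi], by De Morgan. *)
  exists (Not (conj_seq [:: Not phi; Not psi])).
    move=> p /type_not H; apply: contrapT => nv; apply: H.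
    apply/type_conj => chi; rewrite !inE => /orP[] /eqP ->; apply/type_not.
      by move=> /Dphi.
    by move=> /Dpsi.
  move=> p [fp np]; split; split=> // pp; apply: np;
    apply/type_not => /type_conj H.
    by have /type_not := H (Not phi) (mem_head _ _).
  suff /type_not : type_set p (Not psi) by [].
  by apply: H; rewrite !inE eqxx orbT.
have [p0 [_ cl]] := type_space_compact FF filterT.
have fp0 : f p0 <= u.
  rewrite leNgt; apply/negP => up0.
  have : nbhs p0 (f @^-1` [set x | u < x]).
    by apply: cf; apply: lt_nbhsr.
  have DBot : D Bot by move=> p /type_bot.
  move=> /(cl _ _ (ex_intro2 _ _ Bot DBot (@subset_refl _ _))) [q [[fq _] /= uq]].
  by move: (lt_trans fq uq); rewrite ltxx.
have : nbhs p0 (f @^-1` [set x | x < v]).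
  by apply: cf; apply: lt_nbhsl; apply: le_lt_trans uv.
move=> /type_nbhsP[phi [p0phi Dphi]].
have nphi : nbhs p0 [set q | type_set q phi] by apply/type_nbhsP; exists phi.
have [q [[_ nq] qphi]] := cl _ _ (ex_intro2 _ _ phi Dphi (@subset_refl _ _)) nphi.
exact: nq.
Qed.

Lemma continuous_type_fun f :
  (forall p v, f p < v ->
    exists phi, type_set p phi /\ forall q, type_set q phi -> f q < v) ->
  (forall p u, u < f p ->
    exists phi, type_set p phi /\ forall q, type_set q phi -> u < f q) ->
  continuous f.
Proof.
move=> flt fgt p; apply/(@cvgrPdist_lt _ _ _ _ (nbhs_filter p)) => e e0.
have [|phi [pphi H1]] := flt p (f p + e); first by rewrite ltrDl.
have [|psi [ppsi H2]] := fgt p (f p - e); first by rewrite gtrBl.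
have n1 : nbhs p [set q | f q < f p + e] by apply/type_nbhsP; exists phi.
have n2 : nbhs p [set q | f p - e < f q] by apply/type_nbhsP; exists psi.
apply: filterS (filterI n1 n2) => q [/= h1 h2].
by rewrite distrC ltr_distl h1 h2.
Qed.

End TypeSpaceTopology.

(** * Tameness of a quotient flow *)

Section TameQuotientCriterion.
Variables (R : realType) (G : groupType) (Y : topologicalType).
Variables (act : G -> Y -> Y) (E : equiv_rel Y).
Hypothesis invE : invariant_rel act E.
Local Open Scope quotient_scope.

Let pq (y : Y) : quotient_flow E := \pi_(quotient_topology {eq_quot E}) y.

Let pqE x y : pq x = pq y <-> E x y.
Proof. by split=> [/eqmodP|H]; [|apply/eqmodP]. Qed.

Let repr_pq y : E (repr (pq y)) y.
Proof. by apply/pqE; rewrite /pq reprK. Qed.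

(** Continuous functions on the quotient are the continuous [E]-invariant functions on [Y];
    independence passes both ways because the projection is onto and commutes with the action. *)
Lemma tame_flow_quotientP :
  tame_flow R (quotient_act act (E := E)) <->
  forall f : Y -> R, continuous f -> (forall x y, E x y -> f x = f y) ->
    forall g : nat -> G, ~ independent (fun n => translate act (g n) f).
Proof.
split=> [tE f cf Ef g [r [s [rs ind]]]|H f cf [u [ug [r [s [rs ind]]]]]].
  pose fq : quotient_flow E -> R := f \o repr.
  have cfq : continuous fq.
    apply: repr_comp_continuous => // a b /eqP /pqE Eab.
    by apply/eqP; exact: Ef.
  apply: (tE fq cfq).
  exists (fun n => translate (quotient_act act (E := E)) (g n) fq).
  split; first by move=> n; exists (g n).
  exists r, s; split=> // P Q fP fQ PQ.
  have [y [y1 y2]] := ind P Q fP fQ PQ.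
  have E1 n : translate (quotient_act act (E := E)) (g n) fq (pq y)
      = translate act (g n) f y.
    rewrite /translate /fq /= /quotient_act; apply: Ef.
    by apply/pqE; rewrite /pq reprK; apply/pqE/invE/repr_pq.
  by exists (pq y); split=> n nP; rewrite /preimage/= E1; [apply: y1|apply: y2].
have /choice[g Hg] n : exists g, u n = translate (quotient_act act (E := E)) g f.
  by have [g _ <-] := ug n; exists g.
have cfp : continuous (f \o pq) by exact/quotient_continuous.
apply: (H (f \o pq) cfp _ g).
  by move=> x y /pqE /= ->.
exists r, s; split=> // P Q fP fQ PQ.
have [y [y1 y2]] := ind P Q fP fQ PQ.
have E1 n : translate act (g n) (f \o pq) (repr y) = u n y.
  by rewrite Hg.
by exists (repr y); split=> n nP; rewrite /preimage/= E1; [apply: y1|apply: y2].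
Qed.

End TameQuotientCriterion.

(** * An ultrafilter of local retractions *)

Definition local_retractions L (M N : structure L) (j : M -> N)
    (bc : (nat -> M) * (nat -> N)) : set (N -> M) :=
  [set h | (forall n, h (j (bc.1 n)) = bc.1 n) /\ same_type (h \o bc.2) bc.2].

Lemma local_retractions_nonempty I L (M N : structure L) (j : M -> N) bc :
  elementary j -> saturated I M -> local_retractions j bc !=set0.
Proof.
case: bc => b c hj satM.
have [a Ha] := saturated_realize b c hj satM.
have [h Hh] : exists h : N -> M, forall w, h (join_env (j \o b) c w) = join_env b a w.
  (* [h] is well defined on the two tuples because equalities belong to the type; elsewhere its
     value is arbitrary. *)
  exists (fun y => if pselect (exists w, join_env (j \o b) c w = y) is left e
                   then join_env b a (sval (cid e)) else b 0%N) => w.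
  case: pselect => [e|]; last by case; exists w.
  by case: cid => w' /= /(same_type_eq (same_type_sym Ha)).
exists h; split=> [n|] /=; first exact: (Hh (inl n)).
have := same_type_comp inr Ha.
by congr (same_type _ _); apply/funext => n //=; have /= := Hh (inr n).
Qed.

Lemma local_retractions_ultrafilter I L (M N : structure L) (j : M -> N) :
  elementary j -> saturated I M ->
  exists U : set_system (N -> M),
    UltraFilter U /\ forall bc, U (local_retractions j bc).
Proof.
move=> hj satM; have [m0] := carrier_inhabited M.
have Fproper : ProperFilter (filter_from setT (local_retractions j)).
  apply: filter_from_proper; last first.
    by move=> bc _; apply: local_retractions_nonempty hj satM.
  apply: filter_from_filter; first by exists (fun=> m0, fun=> j m0).
  move=> [b c] [b' c'] _ _.
  (* Interleaving the tuples of two pairs gives a single pair imposing both conditions, so the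
     filter base is directed. *)
  pose mix (T : Type) (u u' : nat -> T) n : T :=
    match unpickle n : option (nat + nat) with
    | Some (inl k) => u k | Some (inr k) => u' k | None => u 0%N end.
  have mixl T u u' : @mix T u u' \o (fun k => pickle (inl k : nat + nat)) = u.
    by apply/funext => k /=; rewrite /mix pickleK.
  have mixr T u u' : @mix T u u' \o (fun k => pickle (inr k : nat + nat)) = u'.
    by apply/funext => k /=; rewrite /mix pickleK.
  exists (mix _ b b', mix _ c c') => // h [hb hc] /=.
  split; split=> [n|] /=.
  - by have := hb (pickle (inl n : nat + nat)); rewrite /= /mix pickleK.
  - by have := same_type_comp (fun k => pickle (inl k : nat + nat)) hc;
      rewrite -compA /= mixl.
  - by have := hb (pickle (inr n : nat + nat)); rewrite /= /mix pickleK.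
  - by have := same_type_comp (fun k => pickle (inr k : nat + nat)) hc;
      rewrite -compA /= mixr.
have [U [UU HU]] := ultraFilterLemma Fproper.
by exists U; split=> // bc; apply: HU; exists bc.
Qed.

Lemma type_set_act L I (pi : set (formula L I)) (M : structure L)
    (g : automorphism M) (p : type_space pi M) phi :
  type_set (type_act g p) phi <-> type_set p (subst (aut_inv g) phi).
Proof. by []. Qed.

Lemma type_set_actV L I (pi : set (formula L I)) (M : structure L)
    (g : automorphism M) (p : type_space pi M) phi :
  type_set (type_act (g^-1)%g p) phi <-> type_set p (subst g phi).
Proof. by []. Qed.

Lemma type_set_restr L I (pi : set (formula L I)) (M N : structure L)
    (j : M -> N) (hj : elementary j) (p : type_space pi N) phi :
  type_set (type_restr hj p) phi <-> type_set p (subst j phi).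
Proof. by []. Qed.

(** * The limit section of the restriction map *)

Section LimitExtension.
Variables (L : language) (I : Type) (pi : set (formula L I)).
Variables (M N : structure L) (j : M -> N) (hj : elementary j).
Hypothesis homN : strongly_homogeneous I N.
Variables (U : set_system (N -> M)) (UU : UltraFilter U).
Hypothesis retrU : forall bc, U (local_retractions j bc).

Lemma eventually_same_type (c : nat -> N) :
  U [set h : N -> M | same_type (h \o c) c].
Proof.
have [m0] := carrier_inhabited M.
by apply: filterS (retrU (fun=> m0, c)) => h [].
Qed.

Lemma eventually_retract (b : nat -> M) :
  U [set h : N -> M | forall n, h (j (b n)) = b n].
Proof. by apply: filterS (retrU (b, j \o b)) => h []. Qed.

Section OneType.
Variable p : type_space pi M.

Let ext_set : set (formula L (I + N)) :=
  [set phi | U [set h | type_set p (subst h phi)]].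

(** For a suitable [h], the formulas with parameters [h c] are realized in [M]; an automorphism of
    [N] carrying [j (h c)] to [c] moves the image of this realization to one of the original
    formulas. *)
Lemma limit_ext_consistent : finitely_satisfiable (id : N -> N) ext_set.
Proof.
move=> F /finite_seqP[s ->] sp.
have [c Hc] := subst_support (fun _ : unit => conj_seq s).
have : U [set h | forall phi, phi \in s -> type_set p (subst h phi)].
  elim: s sp {Hc} => [_|phi s IH sp]; first by apply: filterS filterT.
  have h1 : ext_set phi by apply: sp; rewrite /= mem_head.
  have h2 : U [set h | forall phi, phi \in s -> type_set p (subst h phi)].
    by apply: IH => psi ps; apply: sp; rewrite /= in_cons ps orbT.
  apply: filterS (filterI h1 h2) => h [p1 p2] psi.
  by rewrite in_cons => /orP[/eqP ->|/p2].
move=> /(filterI (eventually_same_type c)) /filter_ex[h [hc hs]].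
have [||a Ha] := @type_consistent _ _ _ _ p (subst h @` [set` s]).
- by apply: finite_image; apply: finite_seq.
- by move=> _ [phi /hs ? <-].
have : sat (subst h (conj_seq s)) (join_env a id).
  by apply/sat_subst/sat_conj_seq => phi ps; apply/sat_subst; apply: Ha; exists phi.
rewrite (hj _ _) => sj.
have [g Hg] : exists g : automorphism N, forall n, g (j (h (c n))) = c n.
  apply: (homogeneous_tuples homN (c := j \o (h \o c))).
  exact: same_type_trans (elementary_same_type _ hj) hc.
exists (g \o j \o a) => phi ps.
suff /sat_conj_seq : sat (conj_seq s) (join_env (g \o j \o a) id) by apply.
rewrite -{1}(subst_id (conj_seq s)).
rewrite (Hc tt _ id (g \o j \o h)) => [|n]; last by rewrite /= Hg.
apply/sat_subst.
have := (aut_elementary g _ _).1 sj; rewrite /subst sat_map.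
by congr sat; apply/funext => -[].
Qed.

Lemma limit_ext_complete phi : ext_set phi \/ ext_set (Not phi).
Proof.
have [|H] := in_ultra_setVsetC [set h | type_set p (subst h phi)] UU; first by left.
by right; apply: filterS H => h /type_not.
Qed.

Lemma limit_ext_extends phi : pi phi -> ext_set (formula_map inl phi).
Proof.
move=> piphi; apply: filterS filterT => h _ /=.
rewrite /subst formula_map_comp.
exact: (@type_extends _ _ _ _ p).
Qed.

Definition limit_ext : type_space pi N :=
  TypeSpace limit_ext_consistent limit_ext_complete limit_ext_extends.

End OneType.

Lemma type_set_limit p phi :
  type_set (limit_ext p) phi <-> U [set h | type_set p (subst h phi)].
Proof. by []. Qed.

(** Almost every [h] undoes [j] on the parameters of a given formula. *)
Lemma type_restr_limit p : type_restr hj (limit_ext p) = p.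
Proof.
apply: type_ext => phi; rewrite type_set_restr type_set_limit.
have [b Hb] := subst_support (fun _ : unit => phi).
have E : U [set h | subst h (subst j phi) = phi].
  apply: filterS (eventually_retract b) => h hb /=.
  rewrite subst_comp -[RHS]subst_id; exact: (Hb tt).
split=> [H|H]; last by apply: filterS E => h /= ->.
by have [h /= [-> ]] := filter_ex (filterI E H).
Qed.

Lemma type_set_limit_subst p phi :
  type_set (limit_ext p) (subst j phi) <-> type_set p phi.
Proof. by rewrite -(type_set_restr hj) type_restr_limit. Qed.

Lemma limit_ext_approx p q phi psi (c : nat -> N) :
  type_set (limit_ext p) phi -> type_set (limit_ext q) psi ->
  exists h : N -> M, [/\ type_set p (subst h phi), type_set q (subst h psi)
    & same_type (h \o c) c].
Proof.
move=> H1 H2.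
have [h [? [? ?]]] := filter_ex (filterI H1 (filterI H2 (eventually_same_type c))).
by exists h.
Qed.

End LimitExtension.

(** Homogeneity replaces [h] on the parameters of [phi] and [psi] by an automorphism [g]; the
    translates of [p'] and [q'] by its inverse then contain [phi] and [psi]. *)
Lemma invariant_rel_transfer I L (pi : set (formula L I)) (M : structure L)
    (E : equiv_rel (type_space pi M)) p q :
  strongly_homogeneous I M -> closed (rel_graph E) ->
  invariant_rel (@type_act _ _ pi M) E ->
  (forall phi psi (c : nat -> M), type_set p phi -> type_set q psi ->
    exists h p' q', [/\ same_type (h \o c) c, type_set p' (subst h phi),
      type_set q' (subst h psi) & E p' q']) ->
  E p q.
Proof.
move=> homM /closed_relP cE iE H; apply: cE => phi psi pphi qpsi.
have [c Hc] := subst_support (fun b : bool => if b then phi else psi).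
have [h [p' [q' [hc p'phi q'psi Epq]]]] := H phi psi c pphi qpsi.
have [g Hg] := homogeneous_tuples homM (same_type_sym hc).
exists (type_act g^-1%g p'), (type_act g^-1%g q'); split; last exact: iE.
  by apply/type_set_actV; rewrite (Hc true _ g h).
by apply/type_set_actV; rewrite (Hc false _ g h).
Qed.

(** Rational bounds keep the family of separating formulas, hence that of their parameters,
    countable. *)
Lemma lt_interpolate_rat (R : realType) (x y : R) : (x < y)%R ->
  exists2 q1 : rat, (x < ratr q1)%R & exists2 q2 : rat, (q1 < q2)%R & (ratr q2 < y)%R.
Proof.
move=> /rat_in_itvoo[q1]; rewrite in_itv /= => /andP[xq1 /rat_in_itvoo[q2]].
rewrite in_itv /= => /andP[q12 q2y].
by exists q1 => //; exists q2 => //; rewrite -(ltr_rat R).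
Qed.

Lemma lt_interpolate3 (K : numFieldType) (x y : K) : (x < y)%R ->
  exists u w v : K, [/\ x < u, u < w, w < v & v < y]%R.
Proof.
move=> /midf_lt[xw wy]; have [xu uw] := midf_lt xw; have [wv vy] := midf_lt wy.
by exists ((x + (x + y) / 2) / 2)%R, ((x + y) / 2)%R, (((x + y) / 2 + y) / 2)%R.
Qed.

(** * Tame relations carried from [N] down to [M] *)

Section Compatibility.
Variables (R : realType) (L : language) (I : Type) (pi : set (formula L I)).
Variables (M N : structure L) (j : M -> N) (hj : elementary j).
Hypothesis homM : strongly_homogeneous I M.
Hypothesis homN : strongly_homogeneous I N.
Local Open Scope ring_scope.
Variables (U : set_system (N -> M)) (UU : UltraFilter U).
Hypothesis retrU : forall bc, U (local_retractions j bc).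

Let sec : type_space pi M -> type_space pi N := limit_ext hj homN UU retrU.
Let restr : type_space pi N -> type_space pi M := type_restr hj.

Let same_type_j (c : nat -> N) (h : N -> M) :
  same_type (h \o c) c -> same_type ((j \o h) \o c) c.
Proof. by move=> hc; apply: same_type_trans (elementary_same_type _ hj) hc. Qed.

Lemma continuous_restr (f : type_space pi M -> R) :
  continuous f -> continuous (f \o restr).
Proof.
move=> cf p; apply: (@continuous_comp _ _ _ restr f p); last exact: cf.
move=> A /type_nbhsP[phi [pphi HA]]; apply/type_nbhsP.
by exists (subst j phi); split=> // q qphi; apply: HA.
Qed.

(* [sec_rel F] is the image of [F] under [restr], by [sec_rel_restr] and
   [type_restr_limit]; presented as a preimage, it is visibly transitive. *)
Section RestrictedRelation.
Variable F : equiv_rel (type_space pi N).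
Hypothesis tameF : tame_rel R (@type_act _ _ pi N) F.

Let closedF : closed (rel_graph F). Proof. by case: tameF. Qed.
Let invF : invariant_rel (@type_act _ _ pi N) F. Proof. by case: tameF. Qed.

Definition sec_rel : equiv_rel (type_space pi M).
Proof.
exists (fun p q => F (sec p) (sec q)); split.
- by move=> p; apply: generic_quotient.equiv_refl.
- by move=> p q; apply: generic_quotient.equiv_sym.
- by move=> q p r; apply: generic_quotient.equiv_trans.
Defined.

(** The pair [p], [q] is itself the witness for the transfer: a formula lies in [restr p] when its
    image under [j] lies in [p]. *)
Lemma sec_rel_restr p q : F p q -> sec_rel (restr p) (restr q).
Proof.
move=> Fpq; apply: (invariant_rel_transfer homN closedF invF) => phi psi c.
move=> pphi qpsi; have [h [h1 h2 hc]] := limit_ext_approx c pphi qpsi.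
exists (j \o h), p, q; split=> //; first exact: same_type_j.
  by rewrite -subst_comp.
by rewrite -subst_comp.
Qed.

Lemma sec_rel_closed : closed (rel_graph sec_rel).
Proof.
apply/closed_relP => p q H.
apply: (invariant_rel_transfer homN closedF invF) => phi psi c.
move=> pphi qpsi; have [h [h1 h2 hc]] := limit_ext_approx c pphi qpsi.
have [p' [q' [p'phi q'psi Epq]]] := H _ _ h1 h2.
exists (j \o h), (sec p'), (sec q'); split=> //; first exact: same_type_j.
  by rewrite -subst_comp; apply/type_set_limit_subst.
by rewrite -subst_comp; apply/type_set_limit_subst.
Qed.

Lemma sec_rel_invariant : invariant_rel (@type_act _ _ pi M) sec_rel.
Proof.
move=> g p q Epq.
apply: (invariant_rel_transfer homN closedF invF) => phi psi c.
move=> pphi qpsi; have [h [h1 h2 hc]] := limit_ext_approx c pphi qpsi.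
(* The inverse of [g] moves formulas of the translated types back to [p] and [q], and preserves the
   type of the tuple. *)
exists (j \o (aut_inv g \o h)), (sec p), (sec q); split=> //.
- apply: same_type_j; apply: same_type_trans hc.
  exact: (elementary_same_type (h \o c) (aut_elementary g^-1%g)).
- by rewrite -subst_comp; apply/type_set_limit_subst; rewrite -subst_comp.
- by rewrite -subst_comp; apply/type_set_limit_subst; rewrite -subst_comp.
Qed.

Lemma sec_rel_tame : tame_rel R (@type_act _ _ pi M) sec_rel.
Proof.
split; [exact: sec_rel_closed|exact: sec_rel_invariant|].
apply/(tame_flow_quotientP R sec_rel_invariant) => f cf fE g [r [s [rs ind]]].
(* [phi] pushes values below [r] to values below [u]. Failure of [psi] only gives values at least
   [v], so the new strict bound is [w < v]. *)
have [u [w [v [ru uw wv vs]]]] := lt_interpolate3 rs.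
have [phi [phi1 phi2]] := continuous_separation cf ru.
have [psi [psi1 psi2]] := continuous_separation cf vs.
have [c Hc] := subst_support (fun b : bool => if b then phi else psi).
(* Only [phi] and [psi] matter, so it suffices to imitate [g n] on their parameters. *)
have /choice[g' Hg'] n : exists g' : automorphism N,
    forall k, g' (j (c k)) = j (g n (c k)).
  apply: (homogeneous_tuples homN (c := j \o c) (d := j \o (g n \o c))).
  apply: (same_type_trans (elementary_same_type _ hj)); apply: same_type_sym.
  apply: (same_type_trans (elementary_same_type _ hj)).
  exact: elementary_same_type (aut_elementary _).
have key n p (b : bool) : let chi := if b then phi else psi in
    type_set (restr (type_act (g' n)^-1%g (sec p))) chi <->
    type_set (type_act (g n)^-1%g p) chi.
  move=> chi; rewrite type_set_restr 2!type_set_actV subst_comp.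
  rewrite (Hc b _ (g' n \o j) (j \o g n)); last exact: Hg'.
  by rewrite -subst_comp; apply: type_set_limit_subst.
have [_ _ /(tame_flow_quotientP R invF) tF] := tameF.
have frF p q : F p q -> (f \o restr) p = (f \o restr) q.
  by move=> /sec_rel_restr; apply: fE.
apply: (tF _ (continuous_restr cf) frF g').
exists u, w; split=> // P Q fP fQ PQ.
have [p [pP pQ]] := ind P Q fP fQ PQ.
exists (sec p); split=> n nPQ.
  have := pP n nPQ; rewrite /preimage /= !in_itv /= => /phi1 /(key n p true).
  by move=> /phi2.
have := pQ n nPQ; rewrite /preimage /= !in_itv /= !andbT => sf.
apply: (lt_le_trans wv); rewrite leNgt; apply/negP => /psi1 /(key n p false).
by move=> /psi2 /(lt_trans sf); rewrite ltxx.
Qed.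

End RestrictedRelation.

(** * Tame relations carried from [M] up to [N] *)

Section CoextendedRelation.
Variable F : equiv_rel (type_space pi M).
Hypothesis tameF : tame_rel R (@type_act _ _ pi M) F.

Let closedF : closed (rel_graph F). Proof. by case: tameF. Qed.
Let invF : invariant_rel (@type_act _ _ pi M) F. Proof. by case: tameF. Qed.

Definition restr_rel : equiv_rel (type_space pi N).
Proof.
exists (fun p q => `[< forall g, F (restr (type_act g p)) (restr (type_act g q)) >]).
split.
- by move=> p; apply/asboolP => g; apply: generic_quotient.equiv_refl.
- by move=> p q; apply/asboolP/asboolP => H g;
    rewrite generic_quotient.equiv_sym.
- move=> q p r /asboolP H1 /asboolP H2; apply/asboolP => g.
  exact: generic_quotient.equiv_trans (H1 g) (H2 g).
Defined.

Lemma restr_relP p q : restr_rel p q <->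
  forall g, F (restr (type_act g p)) (restr (type_act g q)).
Proof. by split=> [/asboolP|H]; [|apply/asboolP]. Qed.

Lemma restr_rel_sub p q : restr_rel p q -> F (restr p) (restr q).
Proof. by move=> /restr_relP /(_ 1%g); rewrite !type_act1. Qed.

(** An intersection, over all [g], of preimages of a closed relation under continuous maps. *)
Lemma restr_rel_closed : closed (rel_graph restr_rel).
Proof.
apply/closed_relP => p q H; apply/restr_relP => g.
apply: (closed_relP F).1 => // phi psi pphi qpsi.
have [p' [q' [p'phi q'psi /restr_relP Epq]]] := H _ _ pphi qpsi.
by exists (restr (type_act g p')), (restr (type_act g q')); split.
Qed.

Lemma restr_rel_invariant : invariant_rel (@type_act _ _ pi N) restr_rel.
Proof.
move=> g p q /restr_relP H; apply/restr_relP => k.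
by rewrite -!type_actM.
Qed.

(** For suitable [h], the map [h \o aut_inv g \o j] from [M] to itself preserves the type of [c], so
    [p] and [q] are witnesses for the transfer. *)
Lemma restr_rel_sec p q : F p q -> restr_rel (sec p) (sec q).
Proof.
move=> Fpq; apply/restr_relP => g.
apply: (invariant_rel_transfer homM closedF invF) => phi psi c pphi qpsi.
have {}pphi : type_set (sec p) (subst (aut_inv g) (subst j phi)) := pphi.
have {}qpsi : type_set (sec q) (subst (aut_inv g) (subst j psi)) := qpsi.
have [h [h1 h2 hc]] := limit_ext_approx (aut_inv g \o (j \o c)) pphi qpsi.
exists (h \o (aut_inv g \o j)), p, q; split=> //.
- apply: (same_type_trans hc).
  apply: (same_type_trans (elementary_same_type _ (aut_elementary g^-1%g))).
  exact: elementary_same_type.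
- by rewrite -subst_comp -(subst_comp j).
- by rewrite -subst_comp -(subst_comp j).
Qed.

Lemma restr_rel_tame : tame_rel R (@type_act _ _ pi N) restr_rel.
Proof.
split; [exact: restr_rel_closed|exact: restr_rel_invariant|].
apply/(tame_flow_quotientP R restr_rel_invariant) => f cf fE g [r [s [rs ind]]].
(* Countably many formulas control all values of [f]; the tuple [c] lists their parameters. *)
have /choice[phi Hphi] (uv : rat * rat) : exists phi, uv.1 < uv.2 ->
    (forall p, f p < ratr uv.1 -> type_set p phi) /\
    (forall p, type_set p phi -> f p < ratr uv.2).
  have [uv12|] := boolP (uv.1 < uv.2); last by exists Bot.
  have uv12' : ratr uv.1 < ratr uv.2 :> R by rewrite ltr_rat.
  by have [phi Hphi] := continuous_separation cf uv12'; exists phi.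
have [c Hc] := subst_support phi.
have [h hc] := filter_ex (eventually_same_type UU retrU c).
have [k Hk] := homogeneous_tuples homN (same_type_sym (same_type_j hc)).
(* Although [sec] is not continuous, [fs] is: the automorphism [k] moves the
   countably many parameters of [f] into the image of [j]. *)
pose fs p := f (type_act k^-1%g (sec p)).
have secE p uv : type_set (type_act k^-1%g (sec p)) (phi uv) <->
    type_set p (subst h (phi uv)).
  rewrite type_set_actV (Hc uv _ k (j \o h))// -subst_comp.
  exact: type_set_limit_subst.
have cfs : continuous fs.
  apply: continuous_type_fun => p x.
    move=> px; have [q1 pq1 [q2 q12 q2x]] := lt_interpolate_rat px.
    have [H1 H2] := Hphi (q1, q2) q12.
    exists (subst h (phi (q1, q2))); split; first by apply/secE/H1.
    by move=> q /secE/H2 /lt_trans; apply.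
  move=> xp; have [q1 xq1 [q2 q12 q2p]] := lt_interpolate_rat xp.
  have [H1 H2] := Hphi (q1, q2) q12.
  exists (Not (subst h (phi (q1, q2)))); split.
    by apply/type_not => /secE/H2 /(lt_trans q2p); rewrite ltxx.
  move=> q /type_not nq; apply: (lt_le_trans xq1); rewrite leNgt; apply/negP.
  by move=> /H1 /secE.
have fsF p q : F p q -> fs p = fs q.
  by move=> /restr_rel_sec/restr_rel_invariant H; apply: fE.
(* [d] collects the images of [c] under all the [g m], so that a single [h'] and a single [k'] treat
   every translate at once. *)
pose d n := if unpickle n is Some (m, i) then g m (c i) else c n.
have dE m i : d (pickle (m, i)) = g m (c i) by rewrite /d pickleK.
have [h' hd] := filter_ex (eventually_same_type UU retrU d).
have [k' Hk'] := homogeneous_tuples homN (same_type_sym (same_type_j hd)).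
(* [l n] is the copy of [g n] on [M], with [c] read through [h] and its image through [h']. *)
have /choice[l Hl] n : exists l : automorphism M,
    forall i, l (h (c i)) = h' (g n (c i)).
  apply: (homogeneous_tuples homM (c := h \o c) (d := h' \o (g n \o c))).
  apply: (same_type_trans hc); apply: same_type_sym.
  have dn : d \o (fun i => pickle (n, i)) = g n \o c.
    by apply/funext => i; exact: dE.
  have hg : same_type (h' \o (g n \o c)) (g n \o c).
    by rewrite -dn; exact: (same_type_comp (fun i => pickle (n, i)) hd).
  exact: same_type_trans hg (elementary_same_type c (aut_elementary (g n))).
have key n p uv : type_set (type_act (l n)^-1%g (restr (type_act k' p)))
      (subst h (phi uv)) <-> type_set (type_act (g n)^-1%g p) (phi uv).
  rewrite 2!type_set_actV type_set_restr type_set_act !subst_comp.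
  rewrite (Hc uv _ (aut_inv k' \o (j \o (l n \o h))) (g n))// => i /=.
  by have /= := Hk' (pickle (n, i)); rewrite Hl dE => <-; rewrite aut_funK.
have [_ _ /(tame_flow_quotientP R invF) tF] := tameF.
apply: (tF fs cfs fsF l).
(* The bounds are ordered as [r < q1 < q3 < q0 < q4 < q2 < s]; the new sequence is independent for
   [q3 < q0]. *)
have [q1 rq1 [q2 q12 q2s]] := lt_interpolate_rat rs.
have [q3 [q0 [q4 [q13 q30 q04 q42]]]] := lt_interpolate3 q12.
have [A1 A2] := Hphi (q1, q3) q13; have [B1 B2] := Hphi (q4, q2) q42.
exists (ratr q3), (ratr q0); split=> [|P Q fP fQ PQ]; first by rewrite ltr_rat.
have [p [pP pQ]] := ind P Q fP fQ PQ.
exists (restr (type_act k' p)); split=> n nPQ.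
  have := pP n nPQ; rewrite /preimage /= !in_itv /= => fr.
  by apply: A2; apply/secE/key/A1; apply: lt_trans fr rq1.
have := pQ n nPQ; rewrite /preimage /= !in_itv /= !andbT => sf.
apply: (@lt_le_trans _ _ (ratr q4)); first by rewrite ltr_rat.
rewrite leNgt; apply/negP => /B1 /secE /key /B2 fq.
by have := lt_trans sf (lt_trans fq q2s); rewrite ltxx.
Qed.

End CoextendedRelation.
End Compatibility.

Theorem theorem6p29 (R : realType) (L : language) (T : set (sentence L))
    (lam : Type) (C C' : structure L) (j : C -> C')
    (X : set (lam -> C)) (pi : set (formula L lam))
    (hT : complete_theory T) (hC : models C T) (hC' : models C' T)
    (hj : elementary j)
    (satC : saturated lam C) (homC : strongly_homogeneous lam C)
    (satC' : saturated lam C') (homC' : strongly_homogeneous lam C')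
    (hX : X = realizations C pi)
    (F : equiv_rel (type_space pi C)) (F' : equiv_rel (type_space pi C'))
    (hF : is_F_Tame R F) (hF' : is_F_Tame R F') :
  [set (type_restr hj ab.1, type_restr hj ab.2) | ab in rel_graph F']
    = rel_graph F.
Proof.
have [U [UU retrU]] := local_retractions_ultrafilter hj satC.
apply/seteqP; split=> [_ [[p q] /= Fpq <-]|[p q] Fpq].
  (* Each inclusion uses that one of the two relations is finest. *)
  have := hF'.2 _ (restr_rel_tame hj homC homC' UU retrU hF.1) (p, q) Fpq.
  exact: restr_rel_sub.
have := hF.2 _ (sec_rel_tame hj homC' UU retrU hF'.1) (p, q) Fpq.
exists (limit_ext hj homC' UU retrU p, limit_ext hj homC' UU retrU q) => //=.
by rewrite !type_restr_limit.
Qed.
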